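(* Let $X$ be a finite cell complex with filtrations $F_1X\subseteq\cdots\subseteq F_NX$ and $G_1X\subseteq\cdots\subseteq G_NX$ such that $G_NX=X=F_NX$ and $G_kX\subseteq F_kX$ for all $k$. Let $U$ be the unordered set of columns of the matrix $\mathcal A\tilde{\mathcal T}$ produced by the persistent relative homology algorithm described in the context, regarded as chains in $C(X)$. Then for every $t\in\{1,\dots,N\}$ the set $$\Delta_t=\big(U\cap Z(F_tX,G_tX)\big)\setminus\big(U\cap B(F_tX,G_tX)\big)=\{u\in U: f_{ker}(u)\le t<f_{im}(u)\}$$ represents a basis of $H_*(F_tX,G_tX)=Z(F_tX,G_tX)/B(F_tX,G_tX)$. Consequently the barcode of the persistent relative homology module $$H_*(F_1X,G_1X)\to\cdots\to H_*(F_NX,G_NX)$$ has exactly one bar $[f_{ker}(u),f_{im}(u))$ for each $u\in U$ (bars with $f_{ker}(u)=f_{im}(u)$ being empty and discarded), and $u$ is a relative cycle representative of the corresponding bar. That is, the algorithm is correct: the set of triples $(f_{ker}(u),f_{im}(u),u)$ that it returns encodes an interval decomposition of this module together with relative cycle representatives.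
   Context: Chains and filtrations. Fix a field $\mathbb K$. Let $X$ be a finite cell complex with $m$ cells. $C(X)=\bigoplus_p C_p(X)$ is the total cellular chain space over $\mathbb K$, with basis the cells, and $\partial:C(X)\to C(X)$ is the total boundary operator, $\partial^2=0$. Each $F_tX,G_tX$ is a subcomplex; the same symbol also denotes the subspace of $C(X)$ spanned by its cells, which is mapped into itself by $\partial$. For a cell $\sigma$, $b_F(\sigma)=\min\{t:\sigma\in F_tX\}$, and $b_G$ is defined similarly. Relative cycles and boundaries. $Z(F_tX,G_tX)=\{c\in F_tX:\partial c\in G_tX\}$ and $B(F_tX,G_tX)=\partial(F_tX)+G_tX$. The maps in the persistent relative homology module are induced by inclusion. For $c\in C(X)$, $f_{ker}(c)=\min\{t\in\{1,\dots,N\}:c\in Z(F_tX,G_tX)\}$ and $f_{im}(c)=\min\{t\in\{1,\dots,N\}:c\in B(F_tX,G_tX)\}$. Barcode. An interval module with bar $[b,d)$ is the module equal to $\mathbb K$ at indices $b\le t<d$ and $0$ elsewhere, with identity maps between nonzero copies of $\mathbb K$; the barcode is the multiset of bars in a direct sum decomposition of the module into interval modules. A relative cycle representative of a bar $[b,d)$ is a chain whose class generates that summand for all $b\le t<d$. U-match. A U-match decomposition of $D\in\mathbb K^{n\times m}$ is a tuple $(T,M,D,S)$ with $TM=DS$, $T\in\mathbb K^{n\times n}$ and $S\in\mathbb K^{m\times m}$ upper triangular with all diagonal entries $1$, and $M\in\mathbb K^{n\times m}$ having at most one nonzero entry in each row and in each column. Algorithm. (1) Order the cells of $X$ as $\sigma_1,\dots,\sigma_m$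 with $b_F(\sigma_1)\le\cdots\le b_F(\sigma_m)$, and as $\tau_1,\dots,\tau_m$ with $b_G(\tau_1)\le\cdots\le b_G(\tau_m)$. (2) Let $\mathcal D$ be the $m\times m$ matrix with $\partial(\sigma_j)=\sum_i\mathcal D_{ij}\tau_i$. (3) Let $(\mathcal T,M,\mathcal D,\mathcal S)$ be a U-match decomposition of $\mathcal D$. Index entries by cells: $\mathcal T_{\tau_i\tau_j}=\mathcal T_{ij}$, $\mathcal S_{\sigma_i\sigma_j}=\mathcal S_{ij}$, $M_{\tau_i\sigma_j}=M_{ij}$. A column of any of these matrices indexed by a cell $\alpha$ is identified with a chain, e.g. $COL_\alpha(\mathcal T)=\sum_{\rho}\mathcal T_{\rho\alpha}\,\rho$ and $COL_\alpha(\mathcal S)=\sum_\rho\mathcal S_{\rho\alpha}\,\rho$ ($\rho$ over all cells). (4) Order the cells as $\beta_1,\dots,\beta_m$ so that $f_{im}(COL_{\beta_1}(\mathcal T))\le\cdots\le f_{im}(COL_{\beta_m}(\mathcal T))$, and as $\gamma_1,\dots,\gamma_m$ so that $f_{ker}(COL_{\gamma_1}(\mathcal S))\le\cdots\le f_{ker}(COL_{\gamma_m}(\mathcal S))$. (5) Let $\mathcal A_{ij}=\mathcal T_{\tau_i\beta_j}$ and $\mathcal B_{ij}=\mathcal S_{\tau_i\gamma_j}$. (6) Let $(\tilde{\mathcal T},\tilde M,\mathcal A^{-1}\mathcal B,\tilde{\mathcal S})$ be a U-match decomposition of $\mathcal A^{-1}\mathcal B$. The $i$-th column of $\mathcal A\tilde{\mathcal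 T}$ is regarded as the chain $\sum_k(\mathcal A\tilde{\mathcal T})_{ki}\tau_k$. (7) For each nonzero entry $\tilde M_{ij}$, let $u$ be the $i$-th column of $\mathcal A\tilde{\mathcal T}$ as a chain; if $f_{ker}(u)\ne f_{im}(u)$, put $(f_{ker}(u),f_{im}(u),u)$ in the output set. Return the output set. *)

(* Defs.v *)
From HB Require Import structures.
From mathcomp Require Import all_boot all_order all_algebra.
From mathcomp Require Import generic_quotient ring_quotient.

Set Implicit Arguments.
Unset Strict Implicit.
Unset Printing Implicit Defensive.

Import GRing.Theory.
Local Open Scope ring_scope.
Local Open Scope quotient_scope.

Definition in_bar (b d t : nat) : bool := (b <= t < d)%N.

Definition quotv (K : fieldType) (V : vectType K) (W : {vspace V}) : Type :=
  Quotient.quot (pred_of_vspace W : zmodClosed V).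

Section QuotV.
Variables (K : fieldType) (V : vectType K) (W : {vspace V}).

Let Q := Quotient.quot (pred_of_vspace W : zmodClosed V).

HB.instance Definition _ := GRing.Zmodule.copy (quotv W) Q.

Definition quotv_pi (x : V) : quotv W := \pi_Q x.
Definition quotv_repr (x : quotv W) : V := repr (x : Q).

Lemma quotv_reprK x : quotv_pi (quotv_repr x) = x.
Proof. exact: reprK. Qed.

Lemma quotv_eqP x y : (quotv_pi x == quotv_pi y) = (x - y \in W).
Proof. by rewrite (Quotient.idealrBE (pred_of_vspace W : zmodClosed V)). Qed.

Lemma quotv_piD : {morph quotv_pi : x y / x + y}.
Proof. by move=> x y; rewrite /quotv_pi; exact: (pi_addr (s := Q)). Qed.

Definition quotv_scale (a : K) (x : quotv W) : quotv W :=
  quotv_pi (a *: quotv_repr x).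

Lemma quotv_scaleE a x : quotv_scale a (quotv_pi x) = quotv_pi (a *: x).
Proof.
apply/eqP; rewrite quotv_eqP -scalerBr rpredZ // -quotv_eqP.
by rewrite quotv_reprK.
Qed.

Fact quotv_scaleA a b x :
  quotv_scale a (quotv_scale b x) = quotv_scale (a * b) x.
Proof. by rewrite -[x]quotv_reprK !quotv_scaleE scalerA. Qed.
Fact quotv_scale1 : left_id 1 quotv_scale.
Proof. by move=> x; rewrite -[x]quotv_reprK quotv_scaleE scale1r. Qed.
Fact quotv_scaleDr : right_distributive quotv_scale +%R.
Proof.
move=> a x y; rewrite -[x]quotv_reprK -[y]quotv_reprK.
by rewrite -quotv_piD !quotv_scaleE scalerDr quotv_piD.
Qed.
Fact quotv_scaleDl x : {morph quotv_scale^~ x : a b / a + b}.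
Proof.
move=> a b; rewrite -[x]quotv_reprK !quotv_scaleE scalerDl.
exact: quotv_piD.
Qed.

HB.instance Definition _ := GRing.Zmodule_isLmodule.Build K (quotv W)
  quotv_scaleA quotv_scale1 quotv_scaleDr quotv_scaleDl.

Fact quotv_pi_linear : linear quotv_pi.
Proof. by move=> a x y; rewrite quotv_piD -quotv_scaleE. Qed.
HB.instance Definition _ := GRing.isLinear.Build K V (quotv W) _ quotv_pi
  quotv_pi_linear.

Let coord_of (x : quotv W) : subvs_of (W^C)%VS :=
  vsproj _ (daddv_pi (W^C) W (quotv_repr x)).
Let of_coord (x : subvs_of (W^C)%VS) : quotv W := quotv_pi (vsval x).

Let capCW : (W^C :&: W = 0)%VS.
Proof. by rewrite capvC capv_compl. Qed.
Let addCW : (W^C + W = fullv)%VS.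
Proof. by rewrite addvC addv_complf. Qed.

Let projC y w : y - w \in W -> w \in (W^C)%VS -> daddv_pi (W^C) W y = w.
Proof.
move=> yW wC; rewrite -[y](subrK w) linearD /= (daddv_pi_id capCW wC).
have WC : (W :&: W^C = 0)%VS by rewrite capv_compl.
have := @daddv_pi_add _ _ _ _ (y - w) capCW.
rewrite addCW memvf (daddv_pi_id WC yW) => /(_ isT) /eqP.
by rewrite -subr_eq0 addrK => /eqP ->; rewrite add0r.
Qed.

Let of_coordK : cancel of_coord coord_of.
Proof.
move=> x; apply: val_inj; rewrite /= vsprojK ?memv_pi //.
by apply: projC (subvsP x); rewrite -quotv_eqP quotv_reprK.
Qed.

Let coord_ofK : cancel coord_of of_coord.
Proof.
move=> x; rewrite -[RHS]quotv_reprK; apply/eqP; rewrite quotv_eqP /=.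
rewrite vsprojK ?memv_pi //; set y := quotv_repr x.
have := @daddv_pi_add _ _ _ _ y capCW; rewrite addCW memvf => /(_ isT) h.
by rewrite -{2}h opprD addrA subrr add0r rpredN memv_pi.
Qed.

Fact quotv_vect_iso : Vector.axiom (\dim (W^C)%VS) (quotv W).
Proof.
have [v v_lin v_bij] := subvs_vect_iso (W^C)%VS.
exists (v \o coord_of); last first.
  by apply: bij_comp => //; exact: Bijective coord_ofK of_coordK.
have lin : linear of_coord by move=> a x y; rewrite /of_coord !linearP.
move=> a x y; rewrite /= -v_lin; congr (v _).
by apply: (can_inj of_coordK); rewrite coord_ofK lin !coord_ofK.
Qed.

HB.instance Definition _ := Lmodule_hasFinDim.Build K (quotv W) quotv_vect_iso.

End QuotV.

Section QuotMap.
Variables (K : fieldType) (V V' : vectType K).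
Variables (W : {vspace V}) (W' : {vspace V'}) (f : 'Hom(V, V')).
Hypothesis fW : (f @: W <= W')%VS.

(* The map V / W -> V' / W' induced by f; fW makes it well defined. *)
Definition quot_map of (f @: W <= W')%VS :=
  fun x : quotv W => quotv_pi W' (f (quotv_repr x)).

Lemma quot_mapE x : quot_map fW (quotv_pi W x) = quotv_pi W' (f x).
Proof.
apply/eqP; rewrite quotv_eqP -linearB; apply: (subvP fW).
by rewrite memv_img // -quotv_eqP quotv_reprK.
Qed.

Fact quot_map_linear : linear (quot_map fW).
Proof.
move=> a x y; rewrite -[x]quotv_reprK -[y]quotv_reprK.
by rewrite -linearP !quot_mapE !linearP.
Qed.
HB.instance Definition _ := GRing.isLinear.Build K (quotv W) (quotv W') _
  (quot_map fW) quot_map_linear.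

End QuotMap.

(* A persistence module has n.+1 terms, indexed by 0, ..., n; cur i and nxt i
   are the consecutive indices i and i + 1. *)
Section PersistenceModules.
Variables (K : fieldType) (n : nat).

Definition cur (i : 'I_n) : 'I_n.+1 := widen_ord (leqnSn n) i.
Definition nxt (i : 'I_n) : 'I_n.+1 := lift ord0 i.

Record pmod := Pmod {
  pm_obj :> 'I_n.+1 -> lmodType K;
  pm_map : forall i : 'I_n, {linear pm_obj (cur i) -> pm_obj (nxt i)}
}.

Record pmod_iso (V W : pmod) := PmodIso {
  iso_fun :> forall t, {linear V t -> W t};
  iso_bij : forall t, bijective (iso_fun t);
  iso_nat : forall (i : 'I_n) (x : V (cur i)),
    iso_fun (nxt i) (pm_map V i x) = pm_map W i (iso_fun (cur i) x)
}.

(* 'rV[K]_true is K and 'rV[K]_false is 0; multiplication by the all-ones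
   matrix is the identity from 'rV_true to itself and zero otherwise. *)
Definition interval_obj (b d : nat) (t : 'I_n.+1) : lmodType K :=
  'rV[K]_(in_bar b d t).

Definition interval_map (b d : nat) (i : 'I_n) :
    {linear interval_obj b d (cur i) -> interval_obj b d (nxt i)} :=
  mulmxr (const_mx 1 : 'M[K]_(in_bar b d (cur i), in_bar b d (nxt i))).

Definition interval_pmod (b d : nat) : pmod := Pmod (interval_map b d).

End PersistenceModules.

Definition dsum (K : fieldType) (I : finType) (V : I -> lmodType K) : Type :=
  {dffun forall i, V i}.

Section DirectSum.
Variables (K : fieldType) (I : finType) (V : I -> lmodType K).

Definition dsum_comp (x : dsum V) (i : I) : V i := (x : {dffun _}) i.
Definition dsum_mk (g : forall i, V i) : dsum V := [ffun i => g i].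

HB.instance Definition _ := Choice.on (dsum V).

Lemma dsum_mkE g i : dsum_comp (dsum_mk g) i = g i.
Proof. exact: ffunE. Qed.

Lemma dsumP x y : (forall i, dsum_comp x i = dsum_comp y i) -> x = y.
Proof. by move=> xy; apply/ffunP. Qed.

Let add x y := dsum_mk (fun i => dsum_comp x i + dsum_comp y i).
Let opp x := dsum_mk (fun i => - dsum_comp x i).
Let scale (a : K) x := dsum_mk (fun i => a *: dsum_comp x i).

Fact dsum_addA : associative add.
Proof. by move=> x y z; apply: dsumP => i; rewrite !dsum_mkE addrA. Qed.
Fact dsum_addC : commutative add.
Proof. by move=> x y; apply: dsumP => i; rewrite !dsum_mkE addrC. Qed.
Fact dsum_add0 : left_id (dsum_mk (fun i => 0)) add.
Proof. by move=> x; apply: dsumP => i; rewrite !dsum_mkE add0r. Qed.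
Fact dsum_addN : left_inverse (dsum_mk (fun i => 0)) opp add.
Proof. by move=> x; apply: dsumP => i; rewrite !dsum_mkE addNr. Qed.
HB.instance Definition _ := GRing.isZmodule.Build (dsum V)
  dsum_addA dsum_addC dsum_add0 dsum_addN.

Fact dsum_scaleA a b x : scale a (scale b x) = scale (a * b) x.
Proof. by apply: dsumP => i; rewrite !dsum_mkE scalerA. Qed.
Fact dsum_scale1 : left_id 1 scale.
Proof. by move=> x; apply: dsumP => i; rewrite !dsum_mkE scale1r. Qed.
Fact dsum_scaleDr : right_distributive scale +%R.
Proof. by move=> a x y; apply: dsumP => i; rewrite !dsum_mkE scalerDr. Qed.
Fact dsum_scaleDl x : {morph scale^~ x : a b / a + b}.
Proof. by move=> a b; apply: dsumP => i; rewrite !dsum_mkE scalerDl. Qed.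
HB.instance Definition _ := GRing.Zmodule_isLmodule.Build K (dsum V)
  dsum_scaleA dsum_scale1 dsum_scaleDr dsum_scaleDl.

Lemma dsum_compP (a : K) (x y : dsum V) i :
  dsum_comp (a *: x + y) i = a *: dsum_comp x i + dsum_comp y i.
Proof. by rewrite [LHS]dsum_mkE [in LHS]dsum_mkE. Qed.

End DirectSum.

Section DirectSumMap.
Variables (K : fieldType) (I : finType) (V W : I -> lmodType K).
Variable f : forall i, {linear V i -> W i}.

Definition dsum_map (x : dsum V) : dsum W :=
  dsum_mk (fun i => f i (dsum_comp x i)).

Fact dsum_map_linear : linear dsum_map.
Proof.
move=> a x y; apply: dsumP => i.
rewrite dsum_mkE; apply: etrans (congr1 (f i) (dsum_compP a x y i)) _.
by apply/esym/(etrans (dsum_compP _ _ _ _)); rewrite !dsum_mkE linearP.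
Qed.
HB.instance Definition _ := GRing.isLinear.Build K (dsum V) (dsum W) _
  dsum_map dsum_map_linear.

End DirectSumMap.

Section Barcodes.
Variables (K : fieldType) (n : nat).
Implicit Type V : pmod K n.

Definition pmod_dsum (I : finType) (P : I -> pmod K n) : pmod K n :=
  @Pmod K n (fun t => dsum (fun k => P k t))
    (fun i => dsum_map (fun k => pm_map (P k) i)).

(* A decomposition of V as the direct sum of the interval modules with bars
   [fst (bar k), snd (bar k)), none of which is the zero module. *)
Record interval_decomposition V (I : finType) (bar : I -> nat * nat) :=
  IntervalDecomposition {
    decomp_iso :>
      pmod_iso (pmod_dsum (fun k => interval_pmod K n (bar k).1 (bar k).2)) V;
    decomp_bar : forall k, ((bar k).1 < (bar k).2 <= n.+1)%N
  }.

(* The subspace of V t which is the image of the k-th summand. *)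
Definition in_summand V I bar (phi : @interval_decomposition V I bar)
    (k : I) (t : 'I_n.+1) (y : V t) : Prop :=
  exists x : dsum (fun k => interval_obj K (bar k).1 (bar k).2 t),
    (forall l, l != k -> dsum_comp x l = 0) /\ y = phi t x.

(* s is read as a multiset, that is, up to permutation. *)
Definition is_barcode V (s : seq (nat * nat)) : Prop :=
  exists (I : finType) (bar : I -> nat * nat),
    inhabited (interval_decomposition V bar) /\ perm_eq s [seq bar k | k : I].

End Barcodes.

(* A cell complex enters only through its cells, their dimensions and the
   incidence coefficients over K: incidence s r is the coefficient of r in the
   boundary of s. *)
Record cell_complex (K : fieldType) := CellComplex {
  cell :> finType;
  cell_dim : cell -> nat;
  incidence : cell -> cell -> K;
  incidence_dim : forall s r, incidence s r != 0 -> cell_dim s = (cell_dim r).+1;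
  incidence_sq : forall s r, \sum_q incidence s q * incidence q r = 0
}.

Section CellComplex.
Variables (K : fieldType) (X : cell_complex K).

Definition chain : Type := {ffun X -> K^o}.
HB.instance Definition _ := Vector.on chain.

Definition cell_chain (s : X) : chain := [ffun r => (r == s)%:R].

Definition boundary_fun (c : chain) : chain :=
  [ffun r => \sum_s c s * incidence s r].

Fact boundary_linear : linear boundary_fun.
Proof.
move=> a x y; apply/ffunP => r; rewrite !ffunE /= scaler_sumr -big_split /=.
by apply: eq_bigr => s _; rewrite !ffunE mulrDl -scalerAl.
Qed.
HB.instance Definition _ := GRing.isLinear.Build K chain chain _ boundary_fun
  boundary_linear.

Definition boundary : 'End(chain) := linfun boundary_fun.

(* With field coefficients, the boundary of a cell of a topological subcomplex
   is supported in it; this is the only closure condition imposed. *)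
Definition subcomplex (A : {set X}) : Prop :=
  forall s r, s \in A -> incidence s r != 0 -> r \in A.

Definition span_cells (A : {set X}) : {vspace chain} :=
  <<[seq cell_chain s | s in A]>>%VS.

(* The steps are numbered 0, ..., n: there are N = n.+1 of them, and ord_max is
   the last one. *)
Record filtration (n : nat) := Filtration {
  step :> 'I_n.+1 -> {set X};
  step_subcomplex : forall t, subcomplex (step t);
  step_mono : forall s t : 'I_n.+1, (s <= t)%N -> step s \subset step t
}.

(* An enumeration sigma_0, ..., sigma_(m-1) of the cells, with its inverse. *)
Record cell_order := CellOrder {
  nth_cell :> 'I_#|X| -> X;
  rank : X -> 'I_#|X|;
  nth_cellK : cancel nth_cell rank;
  rankK : cancel rank nth_cell
}.

Definition sorted_by (n : nat) (o : cell_order) (f : X -> 'I_n.+1) : Prop :=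
  forall i j : 'I_#|X|, (i <= j)%N -> (f (o i) <= f (o j))%N.

End CellComplex.

Section RelativeHomology.
Variables (K : fieldType) (X : cell_complex K) (n : nat).
Variables (F G : filtration X n).
Implicit Types (s t : 'I_n.+1) (c u : chain X).

(* In birth, f_ker and f_im the set of admissible t is nonempty as soon as the
   last steps of the filtrations are X; otherwise the value is ord_max. *)
Definition birth (E : filtration X n) (s : X) : 'I_n.+1 :=
  [arg min_(t < ord_max | s \in E t) (t : nat)]%N.

Definition rel_cycles t : {vspace chain X} :=
  (span_cells (F t) :&: boundary X @^-1: span_cells (G t))%VS.

Definition rel_boundaries t : {vspace chain X} :=
  (boundary X @: span_cells (F t) + span_cells (G t))%VS.

Definition f_ker c : 'I_n.+1 :=
  [arg min_(t < ord_max | c \in rel_cycles t) (t : nat)]%N.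

Definition f_im c : 'I_n.+1 :=
  [arg min_(t < ord_max | c \in rel_boundaries t) (t : nat)]%N.

(* The relative boundaries as a subspace of the space of relative cycles. *)
Definition boundaries_in_cycles t : {vspace subvs_of (rel_cycles t)} :=
  (linfun vsval @^-1: rel_boundaries t)%VS.

Definition rel_homology_at t : vectType K := quotv (boundaries_in_cycles t).

(* The class of c at time t; meaningful when c is in rel_cycles t. *)
Definition rel_class t c : rel_homology_at t :=
  quotv_pi (boundaries_in_cycles t) (vsproj (rel_cycles t) c).

Lemma span_cells_mono (A B : {set X}) :
  A \subset B -> (span_cells A <= span_cells B)%VS.
Proof.
move=> AB; apply: sub_span => _ /imageP[s sA ->]; apply/imageP.
by exists s => //; apply: (subsetP AB).
Qed.

Lemma rel_cycles_mono s t : (s <= t)%N -> (rel_cycles s <= rel_cycles t)%VS.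
Proof.
move=> st; apply: capvS; first exact/span_cells_mono/step_mono.
exact/lpreimS/span_cells_mono/step_mono.
Qed.

Lemma rel_boundaries_mono s t :
  (s <= t)%N -> (rel_boundaries s <= rel_boundaries t)%VS.
Proof.
move=> st; apply: addvS; last exact/span_cells_mono/step_mono.
exact/limgS/span_cells_mono/step_mono.
Qed.

Definition cycle_incl s t :
    'Hom(subvs_of (rel_cycles s), subvs_of (rel_cycles t)) :=
  linfun (vsproj (rel_cycles t) \o vsval).

Fact cycle_incl_boundaries s t : (s <= t)%N ->
  (cycle_incl s t @: boundaries_in_cycles s <= boundaries_in_cycles t)%VS.
Proof.
move=> st; apply/subvP => _ /memv_imgP[x xB ->].
move: xB; rewrite -!memv_preim /cycle_incl !lfunE /= => xB.
rewrite vsprojK; first exact: subvP (rel_boundaries_mono st) _ xB.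
exact: subvP (rel_cycles_mono st) _ (subvsP x).
Qed.

Fact cur_le_nxt (i : 'I_n) : (cur i <= nxt i)%N.
Proof. by rewrite /= /bump leqW. Qed.

Definition rel_homology : pmod K n :=
  @Pmod K n (fun t => rel_homology_at t)
    (fun i => quot_map (cycle_incl_boundaries (cur_le_nxt i))).

Definition cycle_representative (I : finType) (bar : I -> nat * nat)
    (phi : interval_decomposition rel_homology bar) (k : I) u : Prop :=
  forall t, in_bar (bar k).1 (bar k).2 t ->
    u \in rel_cycles t /\
    forall y : rel_homology_at t,
      in_summand phi k y <-> exists a : K, y = a *: rel_class t u.

Definition triple u : nat * nat * chain X :=
  (f_ker u : nat, f_im u : nat, u).

(* seq_sub s is the finite type of the elements of s, so that s is read as a
   set: repeated triples count once. *)
Definition encodes_decomposition (s : seq (nat * nat * chain X)) : Prop :=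
  exists phi : interval_decomposition rel_homology
                 (fun x : seq_sub s => (ssval x).1),
    forall x : seq_sub s, cycle_representative phi x (ssval x).2.

End RelativeHomology.

Definition upper_unitriangular (K : fieldType) (p : nat) (A : 'M[K]_p) : Prop :=
  (forall i, A i i = 1) /\ (forall i j : 'I_p, (j < i)%N -> A i j = 0).

Record umatch (K : fieldType) (p q : nat)
    (T : 'M[K]_p) (M D : 'M[K]_(p, q)) (S : 'M[K]_q) : Prop := Umatch {
  umatch_eq : T *m M = D *m S;
  umatch_T : upper_unitriangular T;
  umatch_S : upper_unitriangular S;
  umatch_row : forall i j j', M i j != 0 -> M i j' != 0 -> j = j';
  umatch_col : forall i i' j, M i j != 0 -> M i' j != 0 -> i = i'
}.

Section Algorithm.
Variables (K : fieldType) (X : cell_complex K) (n : nat).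
Local Notation m := #|X|.

Definition boundary_matrix (tau sigma : cell_order X) : 'M[K]_m :=
  \matrix_(i, j) boundary X (cell_chain (sigma j)) (tau i).

(* The entry of A at a pair of cells, when its rows and columns are indexed
   by the cells listed in the order o. *)
Definition cell_entry (o : cell_order X) (A : 'M[K]_m) (r a : X) : K :=
  A (rank o r) (rank o a).

Definition COL (o : cell_order X) (A : 'M[K]_m) (a : X) : chain X :=
  \sum_r cell_entry o A r a *: cell_chain r.

Definition reindex_mx (o row_order col_order : cell_order X) (A : 'M[K]_m) :
    'M[K]_m :=
  \matrix_(i, j) cell_entry o A (row_order i) (col_order j).

Definition col_chain (o : cell_order X) (A : 'M[K]_m) (i : 'I_m) : chain X :=
  \sum_k A k i *: cell_chain (o k).

(* An execution: the choices made by the algorithm (orders refining the given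
   preorders, and U-match decompositions) are arbitrary. *)
Record execution (F G : filtration X n) := Execution {
  sigma : cell_order X;
  tau : cell_order X;
  sigma_sorted : sorted_by sigma (birth F);
  tau_sorted : sorted_by tau (birth G);
  mxT : 'M[K]_m;
  mxM : 'M[K]_m;
  mxS : 'M[K]_m;
  umatch1 : umatch mxT mxM (boundary_matrix tau sigma) mxS;
  beta : cell_order X;
  gamma : cell_order X;
  beta_sorted : sorted_by beta (fun a => f_im F G (COL tau mxT a));
  gamma_sorted : sorted_by gamma (fun a => f_ker F G (COL sigma mxS a));
  mxA : 'M[K]_m := reindex_mx tau tau beta mxT;
  mxB : 'M[K]_m := reindex_mx sigma tau gamma mxS;
  mxT' : 'M[K]_m;
  mxM' : 'M[K]_m;
  mxS' : 'M[K]_m;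
  umatch2 : umatch mxT' mxM' (invmx mxA *m mxB) mxS'
}.

Variables (F G : filtration X n) (E : execution F G).

Definition final_col (i : 'I_m) : chain X :=
  col_chain (tau E) (mxA E *m mxT' E) i.

Definition final_cols : seq (chain X) := [seq final_col i | i : 'I_m].

Definition output : seq (nat * nat * chain X) :=
  [seq triple F G (final_col p.1)
    | p <- enum {: 'I_m * 'I_m} & (mxM' E p.1 p.2 != 0)
        && (f_ker F G (final_col p.1)
            != f_im F G (final_col p.1))].

Definition relative_basis (t : 'I_n.+1) : seq (chain X) :=
  [seq u <- undup final_cols
    | (u \in rel_cycles F G t) && (u \notin rel_boundaries F G t)].

End Algorithm.

(* Main.v *)
Require Import Defs.
From HB Require Import structures.
From mathcomp Require Import all_boot all_order all_algebra.

Set Implicit Arguments.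
Unset Strict Implicit.
Unset Printing Implicit Defensive.

Import GRing.Theory.
Local Open Scope ring_scope.

(** Everything rests on one notion: a basis u of the chain space is adapted to a
subspace W when W is spanned by the u_i that it contains.  If a single basis is
adapted to all the relative cycle spaces Z_t and to all the relative boundary
spaces B_t, which lie in them, then the classes of the u_i in Z_t but not in B_t
form a basis of Z_t / B_t (adapted_classes_basis).  As Z_t and B_t grow with t,
such a u_i is alive exactly from f_ker to f_im, and the maps of the module send
the class of u_i to the class of u_i, so that each u_i spans an interval summand
(decomposition_of_bases, adapted_decomposition).

It remains to see that the algorithm produces such a basis.  Replacing a basis e
by e A with A upper unitriangular preserves the span of every initial segment,
and U-match relations T M = D S are matchings up to nonzero scalars.  Hence in
the first U-match the columns of S span every F_t by an initial segment, the
columns of T do so for every G_t, and the boundary of each column of S is zero or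
a multiple of a column of T, different columns of S giving different ones.
Therefore the columns of T are adapted to every B_t = d F_t + G_t, and those of S
to every Z_t, the preimage of G_t under d in F_t (umatch_boundaries_adapted,
umatch_cycles_adapted).  Sorted by f_im and f_ker, these columns span B_t and Z_t
by initial segments; they are the columns of A and B.  The second U-match reads
B S' = (A T') M'.  The columns of A T' are still adapted to every B_t, those of
B S' to every Z_t, and M' is an invertible matching, so the two families agree up
to order and nonzero scalars: the columns of A T' are adapted to both
filtrations. *)

(** * Bases adapted to a subspace *)

Section Families.
Variables (K : fieldType) (V : vectType K) (I : finType).
Implicit Types (u : I -> V) (P : pred I) (W : {vspace V}) (a : I -> K).

Definition lines u P : {vspace V} := (\sum_(i | P i) <[u i]>)%VS.

Definition adapted u W : Prop := W = lines u (fun i => u i \in W).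

Definition spanning u : Prop := lines u predT = fullv.

Lemma mem_line u P i : P i -> u i \in lines u P.
Proof. by move=> Pi; rewrite memvE; apply: sumv_sup (subvv _). Qed.

Lemma mem_lines u P a :
  (forall i, ~~ P i -> a i = 0) -> \sum_i a i *: u i \in lines u P.
Proof.
move=> aP; rewrite (bigID P) /= [X in _ + X]big1 ?addr0; last first.
  by move=> i /aP ->; rewrite scale0r.
by apply: memv_sumr => i _; rewrite memvZ ?memv_line.
Qed.

Lemma lines_coords u P v : v \in lines u P ->
  exists2 a, forall i, ~~ P i -> a i = 0 & v = \sum_i a i *: u i.
Proof.
case/memv_sumP => w wP ->.
have /fin_all_exists[a aE] i : exists c : K, P i -> w i = c *: u i.
  case Pi: (P i); last by exists 0.
  by have /vlineP[c ->] := wP i Pi; exists c.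
exists (fun i => if P i then a i else 0) => [i /negbTE->//|].
rewrite big_mkcond; apply: eq_bigr => i _.
by case: ifP => [/aE //|_]; rewrite scale0r.
Qed.

Lemma adapted_lift u W v : adapted u W -> v \in W ->
  exists2 a, forall i, u i \notin W -> a i = 0 & v = \sum_i a i *: u i.
Proof. by move=> uW vW; apply: lines_coords; rewrite -uW. Qed.

Lemma eq_lines u u' P : u =1 u' -> lines u P = lines u' P.
Proof. by move=> eu; apply: eq_bigr => i _; rewrite eu. Qed.

Lemma adapted_sub u W : (W <= lines u (fun i => u i \in W))%VS -> adapted u W.
Proof.
move=> sub; apply/eqP; rewrite eqEsubv sub.
by apply/subv_sumP => i; rewrite memvE.
Qed.

Lemma adapted_add u W W' : adapted u W -> adapted u W' -> adapted u (W + W').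
Proof.
move=> uW uW'; apply: adapted_sub; rewrite subv_add {1}uW {2}uW'.
apply/andP; split; apply/subv_sumP => i ui; apply: sumv_sup (subvv _).
  exact: subvP (addvSl _ _) _ ui.
exact: subvP (addvSr _ _) _ ui.
Qed.

Lemma adapted_lines u P : adapted u (lines u P).
Proof.
apply: adapted_sub; apply/subv_sumP => i Pi.
by apply: sumv_sup (subvv _); apply: mem_line.
Qed.

Lemma adapted_eq u u' W : u =1 u' -> adapted u W -> adapted u' W.
Proof. by move=> eu ->; rewrite (eq_lines _ eu); apply: adapted_lines. Qed.

Lemma spanning_free u a : \dim {:V} = #|I| -> spanning u ->
  \sum_i a i *: u i = 0 -> forall i, a i = 0.
Proof.
move=> dimV su.
have : basis_of fullv [seq u i | i : I].
  rewrite basisEdim size_image dimV leqnn andbT -su.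
  by apply/subv_sumP => i _; rewrite -memvE memv_span ?image_f.
move/basis_free; rewrite -[X in free X]/(val (image_tuple u I)).
move/freeP => fr a0 i; rewrite -[i]enum_rankK.
apply: (fr (fun j => a (enum_val j))).
rewrite -[RHS]a0 [RHS](big_enum_val (A := I)) /=.
by apply: eq_bigr => j _; rewrite nth_image.
Qed.

(** Comparing a vector of W with its expansion over the members of the basis
lying in W, freeness forces the other coordinates to vanish. *)
Lemma adapted_coords u W a i : \dim {:V} = #|I| -> spanning u -> adapted u W ->
  \sum_i a i *: u i \in W -> u i \notin W -> a i = 0.
Proof.
move=> dimV su aW vW ui.
have [b bP eab] := adapted_lift aW vW.
have /eqP : a i - b i = 0.
  apply: (spanning_free (a := fun i => a i - b i) dimV su).
  under eq_bigr do rewrite scalerBl.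
  by rewrite sumrB eab subrr.
by rewrite bP // subr0 => /eqP.
Qed.

(** If u_i = u_j with i <> j then u_i - u_j is a nontrivial relation. *)
Lemma spanning_inj u : \dim {:V} = #|I| -> spanning u -> injective u.
Proof.
move=> dimV su i j uij; apply/eqP; apply: contraT => nij.
have: (i == i)%:R - (i == j)%:R = 0 :> K.
  apply: (spanning_free (a := fun k => (k == i)%:R - (k == j)%:R) dimV su).
  under eq_bigr do rewrite scalerBl.
  rewrite sumrB (bigD1 i) //= [X in _ - X](bigD1 j) //= !eqxx !scale1r uij.
  rewrite !big1 ?addr0 ?subrr // => k /negbTE->; exact: scale0r.
by rewrite eqxx (negbTE nij) subr0 => /eqP; rewrite oner_eq0.
Qed.

Lemma lines_reindex u P (h : I -> I) :
  bijective h -> lines (u \o h) (P \o h) = lines u P.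
Proof. by move=> bh; rewrite /lines [RHS](reindex h) //; apply: onW_bij. Qed.

Lemma adapted_reindex u W (h : I -> I) :
  bijective h -> adapted u W -> adapted (u \o h) W.
Proof. by move=> bh ->; rewrite -(lines_reindex _ _ bh); apply: adapted_lines. Qed.

Lemma free_image u P :
  (forall a, \sum_(i | P i) a i *: u i = 0 -> forall i, P i -> a i = 0) ->
  free [seq u i | i in P].
Proof.
move=> fr; rewrite -[X in free X]/(val (image_tuple u P)); apply/freeP => b b0 j.
pose a i := b (enum_rank_in (enum_valP j) i).
have aE k : a (enum_val k) = b k by rewrite /a enum_valK_in.
rewrite -aE; apply: fr (enum_valP j); rewrite -[RHS]b0 [LHS]big_enum_val.
by apply: eq_bigr => k _; rewrite aE nth_image.
Qed.

Lemma basis_image u P : lines u P = fullv ->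
  (forall a, \sum_(i | P i) a i *: u i = 0 -> forall i, P i -> a i = 0) ->
  basis_of fullv [seq u i | i in P].
Proof.
move=> uP fr; apply/andP; split; last exact: free_image.
by rewrite -uP span_def big_image.
Qed.

End Families.

(** * Column operations and matchings *)

Section Combinations.
Variables (K : fieldType) (V : vectType K) (m : nat).
Implicit Types (e u : 'I_m -> V) (A B M : 'M[K]_m) (P : pred 'I_m).

Definition comb e A : 'I_m -> V := fun j => \sum_i A i j *: e i.

Lemma comb_mul e A B : comb e (A *m B) =1 comb (comb e A) B.
Proof.
move=> j; rewrite /comb; under eq_bigr do rewrite mxE scaler_suml.
rewrite exchange_big; apply: eq_bigr => k _; rewrite scaler_sumr.
by apply: eq_bigr => i _; rewrite scalerA mulrC.
Qed.

(** The j-th combination involves only e_i with i <= j, with coefficient 1 on e_j,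
so initial segments keep their span; e_i is recovered by induction on i. *)
Lemma lines_unitriangular e A P : upper_unitriangular A ->
  (forall i j : 'I_m, (i <= j)%N -> P j -> P i) ->
  lines (comb e A) P = lines e P.
Proof.
move=> [A1 A0] Pdown; apply/eqP; rewrite eqEsubv; apply/andP; split.
  apply/subv_sumP => j Pj; rewrite -memvE; apply: mem_lines => i nPi.
  by apply: A0; rewrite ltnNge; apply: contra nPi => /Pdown; apply.
apply/subv_sumP => i; rewrite -memvE.
have [k] := ubnP (i : nat); elim: k i => // k IHk i /[!ltnS] ik Pi.
have -> : e i = comb e A i - \sum_(j | j != i) A j i *: e j.
  by rewrite /comb (bigD1 i) //= A1 scale1r addrK.
rewrite rpredB //; first exact: (mem_line (comb e A)).
apply: rpred_sum => j nji; have [ij|ji|/val_inj eji] := ltngtP i j.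
- by rewrite A0 // scale0r mem0v.
- by apply/memvZ/IHk; [apply: leq_trans ji ik | apply: Pdown Pi; apply: ltnW].
- by rewrite eji eqxx in nji.
Qed.

Lemma adapted_unitriangular e A (W : {vspace V}) : upper_unitriangular A ->
  (forall i j : 'I_m, (i <= j)%N -> e j \in W -> e i \in W) ->
  adapted e W -> adapted (comb e A) W.
Proof.
by move=> uA down ->; rewrite -(lines_unitriangular _ uA) //;
  apply: adapted_lines.
Qed.

Lemma spanning_unitriangular e A :
  upper_unitriangular A -> spanning e -> spanning (comb e A).
Proof. by move=> uA se; rewrite /spanning lines_unitriangular. Qed.

(** Each column of M has at most one nonzero entry, so each combination is zero or
a nonzero multiple of one vector u_i. *)
Lemma lines_matching u M P :
  (forall i i' j, M i j != 0 -> M i' j != 0 -> i = i') ->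
  lines (comb u M) P = lines u (fun i => [exists j, P j && (M i j != 0)]).
Proof.
move=> Mcol; apply/eqP; rewrite eqEsubv; apply/andP; split.
  apply/subv_sumP => j Pj; rewrite -memvE; apply: mem_lines => i.
  move/existsPn => /(_ j); rewrite Pj negbK; exact: eqP.
apply/subv_sumP => i /existsP[j /andP[Pj Mij]]; apply: sumv_sup Pj _.
suff -> : comb u M j = M i j *: u i.
  by rewrite -memvE -{1}[u i]scale1r -(mulVf Mij) -scalerA memvZ ?memv_line.
rewrite /comb (bigD1 i) //= big1 ?addr0 // => k nki.
apply/eqP; rewrite scaler_eq0; apply/orP; left; apply: contraNT nki.
by move/Mcol => /(_ _ Mij) ->.
Qed.

Lemma adapted_matching u M (W : {vspace V}) :
  (forall i i' j, M i j != 0 -> M i' j != 0 -> i = i') ->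
  adapted (comb u M) W -> adapted u W.
Proof. by move=> Mcol ->; rewrite lines_matching //; apply: adapted_lines. Qed.

(** A linear relation between the columns of A would be one between the combined
vectors, which are free as they span. *)
Lemma spanning_comb_unitmx e A :
  \dim {:V} = m -> spanning (comb e A) -> A \in unitmx.
Proof.
move=> dimV sA; rewrite -unitmx_tr -row_free_unit; apply: inj_row_free => w w0.
apply/rowP => j; rewrite mxE.
apply: (spanning_free (a := fun j => w 0 j)) sA _ j; first by rewrite card_ord.
rewrite /comb; under eq_bigr do rewrite scaler_sumr.
rewrite exchange_big big1 //= => i _; under eq_bigr do rewrite scalerA.
rewrite -scaler_suml; move/rowP/(_ i): w0; rewrite !mxE => w0.
suff -> : \sum_k w 0 k * A i k = 0 by rewrite scale0r.
by rewrite -[RHS]w0; apply: eq_bigr => k _; rewrite mxE.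
Qed.

End Combinations.

(** * Cycles and boundaries in a U-match decomposition *)

(** Here es and et are two families in the space of an endomorphism d whose matrix
is D; the predicates P and Q cut out initial segments, standing for the cells of
F_t and of G_t. *)
Section UMatch.
Variables (K : fieldType) (V : vectType K) (m : nat) (d : 'End(V)).
Variables (es et : 'I_m -> V) (T M D S : 'M[K]_m) (P Q : pred 'I_m).
Hypothesis dimV : \dim {:V} = m.
Hypothesis et_spanning : spanning et.
Hypothesis d_es : forall j, d (es j) = comb et D j.
Hypothesis TMDS : umatch T M D S.
Hypothesis P_down : forall i j : 'I_m, (i <= j)%N -> P j -> P i.
Hypothesis Q_down : forall i j : 'I_m, (i <= j)%N -> Q j -> Q i.

(** T M = D S, read on vectors. *)
Lemma umatch_boundary j : d (comb es S j) = comb (comb et T) M j.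
Proof.
rewrite -comb_mul (umatch_eq TMDS) comb_mul /comb linear_sum.
by apply: eq_bigr => i _; rewrite linearZ /= d_es.
Qed.

(** Both summands are spanned by columns of T: the first because d maps each column
of S to zero or to a multiple of a column of T. *)
Lemma umatch_boundaries_adapted :
  adapted (comb et T) (d @: lines es P + lines et Q).
Proof.
apply: adapted_add; last first.
  by rewrite -(lines_unitriangular et (umatch_T TMDS)) //; apply: adapted_lines.
rewrite -(lines_unitriangular es (umatch_S TMDS)) // limg_sum.
under eq_bigr do rewrite limg_line umatch_boundary.
by rewrite -/(lines _ _) (lines_matching _ _ (umatch_col TMDS));
  apply: adapted_lines.
Qed.

(** Let v be the combination of the columns of S in F_t with coefficients a_j.  The
coefficient of d v on column i of T is the sum of the a_j M_ij, which has at most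
one nonzero term because the rows of M have at most one nonzero entry.  So if
d v is in G_t, then so is d of every column of S occurring in v. *)
Lemma umatch_cycles_adapted :
  adapted (comb es S) (lines es P :&: d @^-1: lines et Q).
Proof.
have esS := lines_unitriangular es (umatch_S TMDS) P_down.
have etT := lines_unitriangular et (umatch_T TMDS) Q_down.
have T_spanning := spanning_unitriangular (umatch_T TMDS) et_spanning.
apply: adapted_sub; apply/subvP => v; rewrite memv_cap -memv_preim => /andP[].
rewrite -{1}esS -{1}etT => /lines_coords[a aP ->].
rewrite linear_sum; under eq_bigr do rewrite linearZ /= umatch_boundary.
under eq_bigr do rewrite /comb scaler_sumr.
rewrite exchange_big; under eq_bigr do under eq_bigr do rewrite scalerA.
under eq_bigr do rewrite -scaler_suml.
case/lines_coords => b bQ eab.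
have aMb i : \sum_j a j * M i j = b i.
  apply/eqP; rewrite -subr_eq0; apply/eqP.
  apply: (spanning_free (a := fun i => \sum_j a j * M i j - b i) _ T_spanning).
    by rewrite card_ord.
  by under eq_bigr do rewrite scalerBl; rewrite sumrB eab subrr.
apply: mem_lines => j; apply: contraNeq => aj.
have Pj : P j by apply: contraNT aj => /aP ->.
rewrite memv_cap -memv_preim -{1}esS -{1}etT mem_line //= umatch_boundary.
apply: mem_lines => i nQi; apply/eqP; apply: contraNT aj => Mij.
have := aMb i; rewrite bQ // (bigD1 j) //= big1 ?addr0; last first.
  move=> j' nj; apply/eqP; rewrite mulf_eq0 orbC; apply/orP; left.
  by apply: contraNT nj => /(umatch_row TMDS) /(_ Mij) ->.
by move/eqP; rewrite mulf_eq0 (negbTE Mij) orbF.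
Qed.

End UMatch.

(** * Interval decompositions from compatible bases *)

(** The vectors r k t, for k alive at t, form a basis of V t, and the structure
maps send r k t to r k (t + 1).  Setting r k t to 0 outside the bar of k makes all
sums range over the whole of I. *)
Section Decomposition.
Variables (K : fieldType) (n : nat) (V : pmod K n) (I : finType).
Variables (bar : I -> nat * nat) (r : I -> forall t, V t).

Definition bar_at k (t : 'I_n.+1) : bool := in_bar (bar k).1 (bar k).2 t.

(** The unique entry when p is 1, and 0 when p is 0: the size of the vectors of an
interval module depends on t, and summing is linear in both cases. *)
Definition entry (p : nat) (x : 'rV[K]_p) : K := \sum_j x 0 j.

Lemma entryP p a (x y : 'rV[K]_p) :
  entry (a *: x + y) = a * entry x + entry y.
Proof.
by rewrite /entry mulr_sumr -big_split; apply: eq_bigr => j _; rewrite !mxE.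
Qed.

Lemma entry_const (b : bool) a : b -> entry (const_mx a : 'rV_b) = a.
Proof. by case: b => // _; rewrite /entry big_ord1 mxE. Qed.

Lemma entry_false (b : bool) (x : 'rV[K]_b) : ~~ b -> entry x = 0.
Proof. by case: b x => // x _; apply: big_ord0. Qed.

Lemma entry_ones (b c : bool) (x : 'rV[K]_b) :
  c -> entry (x *m (const_mx 1 : 'M_(b, c))) = entry x.
Proof.
case: c => // _; rewrite /entry big_ord1 mxE; apply: eq_bigr => j _.
by rewrite mxE mulr1.
Qed.

Lemma entry_inj (b : bool) (x : 'rV[K]_b) : entry x = 0 -> x = 0.
Proof.
case: b x => x x0; apply/rowP => -[j lj] //.
move: x0; rewrite /entry big_ord1 mxE; case: j lj => // lj <-.
by congr (x _ _); apply: val_inj.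
Qed.

Notation sum_at t := (dsum (fun k => interval_obj K (bar k).1 (bar k).2 t)).

Definition comb_classes t (x : sum_at t) : V t :=
  \sum_k entry (dsum_comp x k) *: r k t.

Fact comb_classes_linear t : linear (@comb_classes t).
Proof.
move=> a x y; rewrite /comb_classes scaler_sumr -big_split.
apply: eq_bigr => k _; rewrite /= scalerA -scalerDl; congr (_ *: _).
by rewrite -entryP; congr entry; apply: dsum_compP.
Qed.
HB.instance Definition _ t :=
  GRing.isLinear.Build K (sum_at t) (V t) _ (@comb_classes t)
    (@comb_classes_linear t).

Hypothesis bar_proper : forall k, ((bar k).1 < (bar k).2 <= n.+1)%N.
Hypothesis r_outside : forall k t, ~~ bar_at k t -> r k t = 0.
Hypothesis r_map : forall k (i : 'I_n), bar_at k (cur i) ->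
  pm_map V i (r k (cur i)) = r k (nxt i).
Hypothesis r_span : forall t (y : V t), exists a, y = \sum_k a k *: r k t.
Hypothesis r_free : forall t a, \sum_k a k *: r k t = 0 ->
  forall k, bar_at k t -> a k = 0.

(* The inverse of comb_classes selects coordinates with xchoose, which takes a
   boolean predicate on a choiceType: hence the finite functions. *)
Let span_ffun t (y : V t) :
  exists a : {ffun I -> K}, y == \sum_k a k *: r k t.
Proof.
have [a ->] := r_span y; exists (finfun a).
by apply/eqP/eq_bigr => k _; rewrite ffunE.
Qed.

Let coords t (y : V t) : sum_at t :=
  dsum_mk (fun k => const_mx (xchoose (span_ffun y) k)).

Lemma comb_classes_bij t : bijective (@comb_classes t).
Proof.
have coordsK : cancel (@coords t) (@comb_classes t).
  move=> y; rewrite /comb_classes [RHS](eqP (xchooseP (span_ffun y))).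
  apply: eq_bigr => k _; rewrite dsum_mkE.
  have [kt|/r_outside ->] := boolP (bar_at k t); last by rewrite !scaler0.
  by rewrite entry_const.
exists (@coords t) => // x; apply/eqP; rewrite -subr_eq0; apply/eqP.
set z := _ - _; have z0 : comb_classes z = 0.
  by rewrite linearB /= coordsK subrr.
apply: dsumP => k; rewrite [RHS]dsum_mkE; apply: entry_inj.
have [kt|nkt] := boolP (bar_at k t); first exact: (r_free z0 kt).
exact: entry_false nkt.
Qed.

(** On each summand k the cases are whether k is alive at i and at i + 1.  When it
is alive at only one of them, both sides vanish: either the coefficient lies in a
zero space, or r k (i + 1) = 0. *)
Lemma comb_classes_nat (i : 'I_n) (x : sum_at (cur i)) :
  comb_classes
    (pm_map (pmod_dsum (fun k => interval_pmod K n (bar k).1 (bar k).2)) i x)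
  = pm_map V i (comb_classes x).
Proof.
rewrite /comb_classes linear_sum; apply: eq_bigr => k _; rewrite linearZ /=.
rewrite dsum_mkE /=.
have [kn|nkn] := boolP (bar_at k (nxt i)); last first.
  rewrite (r_outside nkn) scaler0.
  have [kc|/r_outside->] := boolP (bar_at k (cur i)); last first.
    by rewrite linear0 scaler0.
  by rewrite r_map // (r_outside nkn) scaler0.
rewrite entry_ones //.
have [kc|nkc] := boolP (bar_at k (cur i)); first by rewrite r_map.
by rewrite entry_false ?scale0r.
Qed.

Definition decomposition_of_bases : interval_decomposition V bar :=
  IntervalDecomposition
    (@PmodIso K n (pmod_dsum (fun k => interval_pmod K n (bar k).1 (bar k).2)) V
      (fun t => @comb_classes t) comb_classes_bij comb_classes_nat)
    bar_proper.

Lemma in_summand_bases k t (y : V t) : bar_at k t ->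
  in_summand decomposition_of_bases k y <-> exists a, y = a *: r k t.
Proof.
move=> kt; split=> [[x [x0 ->]]|[a ->]].
  exists (entry (dsum_comp x k)); rewrite /= /comb_classes (bigD1 k) //=.
  rewrite big1 ?addr0 // => l nlk.
  by rewrite x0 // /entry big1 ?scale0r // => j _; rewrite mxE.
exists (dsum_mk (fun l => if l == k then const_mx a else 0)); split=> [l nlk|].
  by rewrite dsum_mkE (negbTE nlk).
rewrite /= /comb_classes (bigD1 k) //= dsum_mkE eqxx entry_const //.
rewrite big1 ?addr0 // => l nlk; rewrite dsum_mkE (negbTE nlk).
by rewrite /entry big1 ?scale0r // => j _; rewrite mxE.
Qed.

End Decomposition.

(** * Chains and subcomplexes *)

Section CellChains.
Variables (K : fieldType) (X : cell_complex K).
Implicit Types (A : {set X}) (c : chain X).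

Lemma dim_chain : \dim {: chain X} = #|X|.
Proof. by rewrite dimvf; apply: muln1. Qed.

Lemma chain_cells c : c = \sum_s c s *: cell_chain s.
Proof.
apply/ffunP => r; rewrite sum_ffunE (bigD1 r) //= !ffunE eqxx.
rewrite big1 ?addr0; first by rewrite /GRing.scale /= mulr1.
by move=> s nsr; rewrite !ffunE eq_sym (negbTE nsr) scaler0.
Qed.

Lemma span_cells_lines A : span_cells A = lines (@cell_chain K X) (mem A).
Proof. by rewrite /span_cells span_def big_image. Qed.

Lemma spanning_cells : spanning (@cell_chain K X).
Proof.
apply/eqP; rewrite eqEsubv subvf; apply/subvP => c _.
by rewrite [c]chain_cells; apply: mem_lines.
Qed.

Lemma span_cells_setT : span_cells [set: X] = fullv.
Proof.
by rewrite span_cells_lines -spanning_cells; apply: eq_bigl => s; apply: in_setT.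
Qed.

Lemma boundary_cell s : boundary X (cell_chain s) = [ffun r => incidence s r].
Proof.
apply/ffunP => r; rewrite lfunE /= !ffunE (bigD1 s) //= ffunE eqxx mul1r.
by rewrite big1 ?addr0 // => q nq; rewrite ffunE (negbTE nq) mul0r.
Qed.

Lemma boundary_sq c : boundary X (boundary X c) = 0.
Proof.
rewrite [c]chain_cells !linear_sum big1 // => s _; rewrite !linearZ /=.
rewrite boundary_cell; apply/eqP; rewrite scaler_eq0; apply/orP; right.
apply/eqP/ffunP => r; rewrite lfunE /= !ffunE -[RHS](incidence_sq s r).
by apply: eq_bigr => q _; rewrite ffunE.
Qed.

Lemma boundary_subcomplex A :
  subcomplex A -> (boundary X @: span_cells A <= span_cells A)%VS.
Proof.
move=> sA; rewrite {1}span_cells_lines limg_sum; apply/subv_sumP => s As.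
rewrite limg_line -memvE boundary_cell span_cells_lines.
rewrite [X in X \in _]chain_cells; apply: mem_lines => r Ar.
by rewrite ffunE; apply/eqP; apply: contraNT Ar => /(sA _ _ As).
Qed.

End CellChains.

(** * Relative cycles, boundaries and classes *)

Section RelativeHomologyFacts.
Variables (K : fieldType) (X : cell_complex K) (n : nat) (F G : filtration X n).
Implicit Types (t : 'I_n.+1) (c : chain X).

Fact rel_class_linear t : linear (rel_class F G t).
Proof. by move=> a x y; rewrite /rel_class !linearP. Qed.
HB.instance Definition _ t := GRing.isLinear.Build K (chain X)
  (rel_homology_at F G t) _ (rel_class F G t) (rel_class_linear t).

Lemma rel_class_eq0 t c : c \in rel_cycles F G t ->
  (rel_class F G t c == 0) = (c \in rel_boundaries F G t).
Proof.
move=> cZ; rewrite -(linear0 (rel_class F G t)) quotv_eqP linear0 subr0.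
by rewrite -memv_preim lfunE /= vsprojK.
Qed.

Lemma rel_class_surj t (y : rel_homology_at F G t) :
  exists2 c, c \in rel_cycles F G t & y = rel_class F G t c.
Proof.
exists (vsval (quotv_repr y)); first exact: subvsP.
by rewrite /rel_class vsvalK quotv_reprK.
Qed.

Lemma rel_homology_map (i : 'I_n) c : c \in rel_cycles F G (cur i) ->
  pm_map (rel_homology F G) i (rel_class F G (cur i) c)
    = rel_class F G (nxt i) c.
Proof.
by move=> cZ; rewrite /rel_class /= quot_mapE lfunE /= vsprojK.
Qed.

Hypothesis G_sub_F : forall t, G t \subset F t.

(** This is where d d = 0, the closure of subcomplexes under d and the inclusion of
G_t in F_t enter. *)
Lemma boundaries_sub_cycles t : (rel_boundaries F G t <= rel_cycles F G t)%VS.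
Proof.
have GF := span_cells_mono (G_sub_F t).
have Fsub := boundary_subcomplex (@step_subcomplex _ _ _ F t).
have Gsub := boundary_subcomplex (@step_subcomplex _ _ _ G t).
apply/subvP => _ /memv_addP[_ /memv_imgP[c cF ->] [g gG ->]].
rewrite memv_cap -memv_preim linearD /= boundary_sq add0r; apply/andP; split.
  apply: rpredD; last exact: subvP GF _ gG.
  by apply: (subvP Fsub); apply: memv_img.
by apply: (subvP Gsub); apply: memv_img.
Qed.

Hypothesis F_last : F ord_max = [set: X].
Hypothesis G_last : G ord_max = [set: X].

(** The set defining f_ker c is nonempty, as every chain is a relative cycle at the
last step, and it is upward closed. *)
Lemma mem_rel_cycles t c : (c \in rel_cycles F G t) = (f_ker F G c <= t)%N.
Proof.
rewrite /f_ker; case: arg_minnP => [|s cs smin].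
  by rewrite memv_cap -memv_preim F_last G_last span_cells_setT !memvf.
by apply/idP/idP => [/smin //|/rel_cycles_mono/subvP]; apply.
Qed.

Lemma mem_rel_boundaries t c :
  (c \in rel_boundaries F G t) = (f_im F G c <= t)%N.
Proof.
rewrite /f_im; case: arg_minnP => [|s cs smin].
  rewrite /rel_boundaries G_last span_cells_setT.
  exact: subvP (addvSr _ _) _ (memvf _).
by apply/idP/idP => [/smin //|/rel_boundaries_mono/subvP]; apply.
Qed.

Lemma f_ker_le_f_im c : (f_ker F G c <= f_im F G c)%N.
Proof.
rewrite -mem_rel_cycles; apply: subvP (boundaries_sub_cycles _) _ _.
by rewrite mem_rel_boundaries.
Qed.

Lemma alive_at t c :
  (c \in rel_cycles F G t) && (c \notin rel_boundaries F G t)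
    = in_bar (f_ker F G c) (f_im F G c) t.
Proof. by rewrite mem_rel_cycles mem_rel_boundaries -ltnNge. Qed.

(** * Homology of a pair of filtrations with a common adapted basis *)

Section AdaptedBasis.
Variables (J : finType) (u : J -> chain X).
Hypothesis dimJ : \dim {: chain X} = #|J|.
Hypothesis u_spanning : spanning u.
Hypothesis u_cycles : forall t, adapted u (rel_cycles F G t).
Hypothesis u_boundaries : forall t, adapted u (rel_boundaries F G t).

Definition alive t j := in_bar (f_ker F G (u j)) (f_im F G (u j)) t.

(** A class is that of a cycle, which is a combination of the u_j in Z_t; those in
B_t have class zero. *)
Lemma adapted_classes_span t (y : rel_homology_at F G t) :
  exists a, y = \sum_(j | alive t j) a j *: rel_class F G t (u j).
Proof.
have [c cZ ->] := rel_class_surj y.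
have [a aZ ->] := adapted_lift (u_cycles t) cZ; exists a.
rewrite linear_sum [RHS]big_mkcond; apply: eq_bigr => j _; rewrite linearZ /=.
rewrite /alive -alive_at; case: ifP => // /nandP[/aZ ->|]; first exact: scale0r.
rewrite negbK => jB; apply/eqP; rewrite scaler_eq0 orbC rel_class_eq0 ?jB //.
exact: subvP (boundaries_sub_cycles t) _ jB.
Qed.

(** If the combination has class zero then it lies in B_t, so it has no coordinate
on any u_j outside B_t. *)
Lemma adapted_classes_free t a :
  \sum_(j | alive t j) a j *: rel_class F G t (u j) = 0 ->
  forall j, alive t j -> a j = 0.
Proof.
pose b j := if alive t j then a j else 0.
move=> a0 j jt; have -> : a j = b j by rewrite /b jt.
have [jZ jB] : u j \in rel_cycles F G t /\ u j \notin rel_boundaries F G t.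
  by apply/andP; rewrite alive_at.
apply: (adapted_coords dimJ u_spanning (u_boundaries t) _ jB).
rewrite -rel_class_eq0; last first.
  apply: rpred_sum => k _; rewrite /b /alive -alive_at.
  by case: ifP => [/andP[kZ _]|]; [apply: memvZ | rewrite scale0r mem0v].
rewrite -[X in _ == X]a0 linear_sum [X in _ == X]big_mkcond; apply/eqP.
by apply: eq_bigr => k _; rewrite linearZ /b /=; case: ifP; rewrite ?scale0r.
Qed.

Lemma adapted_classes_basis t :
  basis_of fullv [seq rel_class F G t (u j) | j in alive t].
Proof.
apply: basis_image; last exact: adapted_classes_free.
apply/eqP; rewrite eqEsubv subvf; apply/subvP => y _.
have [a ->] := adapted_classes_span y.
by apply: rpred_sum => j jt; apply/memvZ/mem_line.
Qed.

(** The summands are indexed by an arbitrary type I enumerating, through h, the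
basis vectors with a nonempty bar; bar and w are separate from h so that they can
be the components of the triples in the output of the algorithm. *)
Lemma adapted_decomposition (I : finType) (h : I -> J)
    (bar : I -> nat * nat) (w : I -> chain X) :
  injective h ->
  (forall j, f_ker F G (u j) != f_im F G (u j) -> j \in codom h) ->
  (forall k, f_ker F G (u (h k)) != f_im F G (u (h k))) ->
  (forall k, triple F G (u (h k)) = (bar k, w k)) ->
  exists phi : interval_decomposition (rel_homology F G) bar,
    forall k, cycle_representative phi k (w k).
Proof.
move=> h_inj h_surj h_bar h_triple.
have barE k : bar k = (f_ker F G (u (h k)) : nat, f_im F G (u (h k)) : nat).
  by have [-> _] := h_triple k.
have wE k : w k = u (h k) by have [_ ->] := h_triple k.
pose r k t : rel_homology_at F G t :=
  if alive t (h k) then rel_class F G t (u (h k)) else 0.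
have aliveE k t : bar_at bar k t = alive t (h k) by rewrite /bar_at barE.
have sum_r t (a : J -> K) : \sum_k a (h k) *: r k t
    = \sum_(j | alive t j) a j *: rel_class F G t (u j).
  have -> : \sum_k a (h k) *: r k t
      = \sum_(k | alive t (h k)) a (h k) *: rel_class F G t (u (h k)).
    rewrite [RHS]big_mkcond; apply: eq_bigr => k _; rewrite /r.
    by case: ifP; rewrite ?scaler0.
  rewrite -(big_imset (fun j => a j *: rel_class F G t (u j)));
    last by move=> x y _ _; apply: h_inj.
  apply: eq_bigl => j; apply/imsetP/idP => [[k kt ->] //|jt].
  have /codomP[k jk] : j \in codom h.
    apply: h_surj; apply: contraTneq jt; rewrite /alive /in_bar => ->.
    by rewrite ltnNge andbN.
  by exists k; rewrite // unfold_in -jk.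
have bar_proper k : ((bar k).1 < (bar k).2 <= n.+1)%N.
  rewrite barE /= ltn_neqAle h_bar f_ker_le_f_im /=; exact: ltnW.
have r_outside k t : ~~ bar_at bar k t -> r k t = 0.
  by rewrite aliveE /r => /negbTE->.
have r_map k (i : 'I_n) : bar_at bar k (cur i) ->
    pm_map (rel_homology F G) i (r k (cur i)) = r k (nxt i).
  rewrite aliveE /r => kt; rewrite kt.
  have kZ : u (h k) \in rel_cycles F G (cur i).
    by move: kt; rewrite /alive -alive_at => /andP[].
  rewrite rel_homology_map //; case: ifP => // /negbT.
  have kZ' := subvP (rel_cycles_mono F G (cur_le_nxt i)) _ kZ.
  by rewrite /alive -alive_at kZ' negbK -rel_class_eq0 // => /eqP.
have r_span t (y : rel_homology F G t) : exists a, y = \sum_k a k *: r k t.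
  have [a ->] := adapted_classes_span y; exists (a \o h); exact/esym/sum_r.
have r_free t a : \sum_k a k *: r k t = 0 ->
    forall k, bar_at bar k t -> a k = 0.
  move=> a0 k; rewrite aliveE => kt.
  (* b extends a along the injection h, by 0 off its image. *)
  pose b j := if [pick l | h l == j] is Some l then a l else 0.
  have bE l : b (h l) = a l.
    by rewrite /b; case: pickP => [l' /eqP/h_inj-> //|/(_ l)]; rewrite eqxx.
  rewrite -bE; apply: adapted_classes_free kt; rewrite -sum_r -[RHS]a0.
  by apply: eq_bigr => l _; rewrite bE.
exists (@decomposition_of_bases _ _ (rel_homology F G) _ _ r
          bar_proper r_outside r_map r_span r_free).
move=> k t kt; split; last first.
  have <- : r k t = rel_class F G t (w k) by rewrite /r -aliveE /bar_at kt wE.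
  by move=> y; apply: in_summand_bases.
by move: kt; rewrite barE -alive_at wE => /andP[].
Qed.

End AdaptedBasis.
End RelativeHomologyFacts.

(** * Executions of the algorithm *)

Section Execution.
Variables (K : fieldType) (X : cell_complex K) (n : nat) (F G : filtration X n).
Hypothesis F_last : F ord_max = [set: X].
Hypothesis G_last : G ord_max = [set: X].

Lemma mem_step (H : filtration X n) t s :
  H ord_max = [set: X] -> (s \in H t) = (birth H s <= t)%N.
Proof.
move=> H_last; rewrite /birth; case: arg_minnP => [|t' st' tmin].
  by rewrite H_last inE.
apply/idP/idP => [/tmin //|le_t]; exact: subsetP (step_mono H le_t) _ st'.
Qed.

Lemma sorted_prefix (H : filtration X n) (o : cell_order X) t (i j : 'I_#|X|) :
  H ord_max = [set: X] -> sorted_by o (birth H) ->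
  (i <= j)%N -> o j \in H t -> o i \in H t.
Proof. by move=> Hl so ij; rewrite !mem_step //; apply: leq_trans; apply: so. Qed.

Lemma order_bij (o : cell_order X) : bijective o.
Proof. exact: Bijective (@nth_cellK _ _ o) (@rankK _ _ o). Qed.

Lemma rank_bij (o o' : cell_order X) : bijective (rank o \o o').
Proof.
apply: bij_comp (order_bij o').
exact: Bijective (@rankK _ _ o) (@nth_cellK _ _ o).
Qed.

Definition ordered_cells (o : cell_order X) : 'I_#|X| -> chain X :=
  fun i => cell_chain (o i).

Lemma lines_ordered_cells (o : cell_order X) (P : pred X) :
  lines (ordered_cells o) (P \o o) = lines (@cell_chain K X) P.
Proof. by rewrite /lines [RHS](reindex o) //; apply/onW_bij/order_bij. Qed.

Lemma ordered_cells_spanning o : spanning (ordered_cells o).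
Proof. by rewrite /spanning -spanning_cells -(lines_ordered_cells o). Qed.

Lemma span_cells_ordered o (A : {set X}) :
  span_cells A = lines (ordered_cells o) (fun i => o i \in A).
Proof. by rewrite span_cells_lines -(lines_ordered_cells o). Qed.

Lemma COL_comb o A a : COL o A a = comb (ordered_cells o) A (rank o a).
Proof.
rewrite /COL /comb (reindex o) /=; last exact/onW_bij/order_bij.
by apply: eq_bigr => i _; rewrite /cell_entry nth_cellK.
Qed.

(** Rows are relabelled together with the cells that they stand for, hence only the
order of the columns changes. *)
Lemma comb_reindex o row_order col_order A :
  comb (ordered_cells row_order) (reindex_mx o row_order col_order A)
    =1 comb (ordered_cells o) A \o (rank o \o col_order).
Proof.
move=> j; rewrite /= -COL_comb /COL [RHS](reindex row_order) /=.
  by apply: eq_bigr => i _; rewrite mxE.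
exact/onW_bij/order_bij.
Qed.

Hypothesis G_sub_F : forall t, G t \subset F t.
Variable E : execution F G.

Let et := ordered_cells (tau E).
Let es := ordered_cells (sigma E).

Lemma dim_chain_ord : \dim {: chain X} = #|'I_#|X| |.
Proof. by rewrite card_ord dim_chain. Qed.

Lemma boundary_matrixE j :
  boundary X (es j) = comb et (boundary_matrix (tau E) (sigma E)) j.
Proof.
rewrite [LHS]chain_cells (reindex (tau E)) /=; last exact/onW_bij/order_bij.
by apply: eq_bigr => i _; rewrite mxE.
Qed.

Lemma T_adapted t : adapted (comb et (mxT E)) (rel_boundaries F G t).
Proof.
rewrite /rel_boundaries (span_cells_ordered (sigma E)).
rewrite (span_cells_ordered (tau E)).
apply: umatch_boundaries_adapted boundary_matrixE (umatch1 E) _ _ => i j.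
  exact: sorted_prefix (sigma_sorted E).
exact: sorted_prefix (tau_sorted E).
Qed.

Lemma S_adapted t : adapted (comb es (mxS E)) (rel_cycles F G t).
Proof.
rewrite /rel_cycles (span_cells_ordered (sigma E)).
rewrite (span_cells_ordered (tau E)).
apply: (umatch_cycles_adapted (dim_chain X) (ordered_cells_spanning _)
          boundary_matrixE (umatch1 E)) => i j.
  exact: sorted_prefix (sigma_sorted E).
exact: sorted_prefix (tau_sorted E).
Qed.

Lemma A_spanning : spanning (comb et (mxA E)).
Proof.
rewrite /spanning (eq_lines _ (comb_reindex _ _ _ _)).
rewrite (lines_reindex _ predT (rank_bij _ _)).
exact/spanning_unitriangular/ordered_cells_spanning/(umatch_T (umatch1 E)).
Qed.

Lemma B_spanning : spanning (comb et (mxB E)).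
Proof.
rewrite /spanning (eq_lines _ (comb_reindex _ _ _ _)).
rewrite (lines_reindex _ predT (rank_bij _ _)).
exact/spanning_unitriangular/ordered_cells_spanning/(umatch_S (umatch1 E)).
Qed.

Lemma A_adapted t : adapted (comb et (mxA E)) (rel_boundaries F G t).
Proof.
apply: (adapted_eq (fun j => esym (comb_reindex _ _ _ _ j))).
exact: adapted_reindex (rank_bij _ _) (T_adapted t).
Qed.

Lemma B_adapted t : adapted (comb et (mxB E)) (rel_cycles F G t).
Proof.
apply: (adapted_eq (fun j => esym (comb_reindex _ _ _ _ j))).
exact: adapted_reindex (rank_bij _ _) (S_adapted t).
Qed.

Lemma final_colE : final_col E =1 comb (comb et (mxA E)) (mxT' E).
Proof. exact: comb_mul. Qed.

Lemma final_col_spanning : spanning (final_col E).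
Proof.
rewrite /spanning (eq_lines _ final_colE).
exact: spanning_unitriangular (umatch_T (umatch2 E)) A_spanning.
Qed.

(** Columns of A are sorted by f_im, so those in B_t form an initial segment, whose
span is not changed by T'. *)
Lemma final_col_boundaries t : adapted (final_col E) (rel_boundaries F G t).
Proof.
apply: (adapted_eq (fsym final_colE)).
apply: adapted_unitriangular (umatch_T (umatch2 E)) _ (A_adapted t) => i j ij.
rewrite !comb_reindex /= -!COL_comb !mem_rel_boundaries //.
exact/leq_trans/(beta_sorted E).
Qed.

(** B S' = A (A^-1 B S') = A T' M'. *)
Lemma final_col_match : comb et (mxB E *m mxS' E) =1 comb (final_col E) (mxM' E).
Proof.
move=> j; rewrite -[final_col E]/(comb et (mxA E *m mxT' E)) -comb_mul.
rewrite -mulmxA (umatch_eq (umatch2 E)) !mulmxA mulmxV ?mul1mx //.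
exact: spanning_comb_unitmx (dim_chain X) A_spanning.
Qed.

(** Columns of B are sorted by f_ker, so B S' is adapted to Z_t; its columns are
multiples of final columns. *)
Lemma final_col_cycles t : adapted (final_col E) (rel_cycles F G t).
Proof.
apply: adapted_matching (umatch_col (umatch2 E)) _.
apply: (adapted_eq final_col_match).
apply: (adapted_eq (fsym (comb_mul _ _ _))).
apply: adapted_unitriangular (umatch_S (umatch2 E)) _ (B_adapted t) => i j ij.
rewrite !comb_reindex /= -!COL_comb !mem_rel_cycles //.
exact/leq_trans/(gamma_sorted E).
Qed.

(** M' is invertible since the columns of B S' span; hence no final column is missed
by the output. *)
Lemma final_match_row i : exists j, mxM' E i j != 0.
Proof.
have uM : mxM' E \in unitmx.
  apply: (spanning_comb_unitmx (e := final_col E) (dim_chain X)).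
  rewrite /spanning -(eq_lines _ final_col_match) (eq_lines _ (comb_mul _ _ _)).
  exact: spanning_unitriangular (umatch_S (umatch2 E)) B_spanning.
apply/existsP; apply: contraT => /existsPn M0.
have /matrixP/(_ i i) := mulmxV uM; rewrite !mxE eqxx big1 => [/esym/eqP|j _].
  by rewrite oner_eq0.
by move: (M0 j); rewrite negbK => /eqP->; rewrite mul0r.
Qed.

Lemma final_col_inj : injective (final_col E).
Proof. exact: spanning_inj dim_chain_ord final_col_spanning. Qed.

Lemma final_cols_uniq : uniq (final_cols E).
Proof. by rewrite map_inj_uniq ?enum_uniq //; apply: final_col_inj. Qed.

(** Every final column with a nonempty bar is listed, as each row of M' has a nonzero
entry. *)
Lemma mem_output p :
  p \in output E =
    (p \in [seq triple F G u | u <- final_cols E & f_ker F G u != f_im F G u]).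
Proof.
apply/mapP/mapP => [[[i j]]|[u]]; rewrite mem_filter.
  move=> /andP[/andP[_ nf] _] ->; exists (final_col E i) => //.
  by rewrite mem_filter nf /= map_f // mem_enum.
move=> /andP[nf /mapP[i _ eu]] ->; subst u; have [j Mij] := final_match_row i.
by exists (i, j); rewrite // mem_filter /= Mij nf mem_enum.
Qed.

Lemma relative_basisE t : relative_basis E t
  = [seq final_col E i | i in alive F G (final_col E) t].
Proof.
rewrite /relative_basis undup_id ?final_cols_uniq // filter_map; congr map.
rewrite enumT [RHS]/enum_mem; apply: eq_filter => i.
by rewrite /= alive_at.
Qed.

Lemma output_decomposition : encodes_decomposition F G (output E).
Proof.
have x_col (x : seq_sub (output E)) : exists i,
    (ssval x == triple F G (final_col E i))
    && (f_ker F G (final_col E i) != f_im F G (final_col E i)).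
  have := ssvalP x; rewrite mem_output => /mapP[u]; rewrite mem_filter.
  by move=> /andP[nf /mapP[i _ eu]] ->; exists i; rewrite -eu eqxx.
pose h x := xchoose (x_col x).
have hP x : ssval x = triple F G (final_col E (h x)) /\
    f_ker F G (final_col E (h x)) != f_im F G (final_col E (h x)).
  by have /andP[/eqP] := xchooseP (x_col x).
apply: (adapted_decomposition G_sub_F F_last G_last dim_chain_ord
          final_col_spanning final_col_cycles final_col_boundaries (h := h)).
- by move=> x y hxy; apply: val_inj; rewrite /= (hP x).1 (hP y).1 hxy.
- move=> i nf; have iO : triple F G (final_col E i) \in output E.
    rewrite mem_output map_f // mem_filter nf /=; apply: map_f.
    exact: mem_enum.
  apply/codomP; exists (SeqSub iO); apply: final_col_inj.
  by have [] := hP (SeqSub iO); case.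
- by move=> x; case: (hP x).
- by move=> x; rewrite -(hP x).1; case: (ssval x).
Qed.

End Execution.

Theorem mainTheorem1 (K : fieldType) (X : cell_complex K) (n : nat)
    (F G : filtration X n)
    (F_last : F ord_max = [set: X]) (G_last : G ord_max = [set: X])
    (G_sub_F : forall k : 'I_n.+1, G k \subset F k)
    (E : execution F G) :
  [/\ forall t : 'I_n.+1,
        (forall u : chain X, u \in relative_basis E t <->
           u \in final_cols E /\ (f_ker F G u <= t < f_im F G u)%N)
        /\ basis_of fullv [seq rel_class F G t u | u <- relative_basis E t],
      is_barcode (rel_homology F G)
        [seq (f_ker F G u : nat, f_im F G u : nat)
          | u <- undup (final_cols E) & f_ker F G u != f_im F G u],
      output E =i [seq triple F G u
                    | u <- final_cols E & f_ker F G u != f_im F G u]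
    & encodes_decomposition F G (output E)].
Proof.
have decomp := output_decomposition F_last G_last G_sub_F E.
split=> [t|||//]; last exact: mem_output.
  split=> [u|].
    rewrite mem_filter mem_undup alive_at //.
    by split=> [/andP[ut ->]|[-> ut]]; rewrite ?andbT.
  rewrite relative_basisE // -map_comp.
  apply: (adapted_classes_basis G_sub_F F_last G_last (dim_chain_ord X) _ _ _ t).
  - exact: final_col_spanning.
  - exact: final_col_cycles.
  - exact: final_col_boundaries.
have [phi _] := decomp.
exists (seq_sub (output E)), (fun x => (ssval x).1); split; first by exists.
rewrite undup_id ?final_cols_uniq //.
set s := filter _ _.
have -> : [seq (f_ker F G u : nat, f_im F G u : nat) | u <- s]
    = [seq p.1 | p <- [seq triple F G u | u <- s]] by rewrite -map_comp.
have -> : [seq (ssval x).1 | x : seq_sub (output E)]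
    = [seq p.1 | p <- [seq val x | x : seq_sub (output E)]].
  by rewrite -[RHS]map_comp.
apply/perm_map/uniq_perm => [||p].
- rewrite map_inj_uniq; last by move=> u v [].
  by rewrite filter_uniq ?final_cols_uniq.
- by rewrite map_inj_uniq ?enum_uniq //; apply: val_inj.
rewrite -mem_output //; apply/idP/mapP => [pO|[x _ ->]]; last exact: ssvalP.
by exists (SeqSub pO); rewrite ?mem_enum.
Qed.
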